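(* Let $\Gamma$ be an $n$-player extensive-form game with perfect recall. Let $$\mathcal Y=\{(\lambda,\tilde y_1,\dots,\tilde y_n):\ \lambda\in\Delta^n,\ \tilde y_i\in\lambda_iQ_i\ \text{for all } i\},$$ where $\Delta^n=\{\lambda\in\mathbb R_{\ge0}^n:\sum_i\lambda_i=1\}$ and $\lambda_iQ_i=\{\lambda_i y:y\in Q_i\}$. Then $\mathcal Y$ is a convex polytope, and a correlation plan $\xi\in\Xi$ is an NFCCE if and only if $$\max_{(\lambda,\tilde y)\in\mathcal Y}\ \sum_{i=1}^n\big(\xi^\top A_i\tilde y_i-\lambda_i b_i^\top\xi\big)\le 0.$$ Since an NFCCE always exists, in particular any $$\xi\in\operatorname*{argmin}_{\xi\in\Xi}\ \max_{(\lambda,\tilde y)\in\mathcal Y}\ \sum_{i=1}^n\big(\xi^\top A_i\tilde y_i-\lambda_i b_i^\top\xi\big)$$ is guaranteed to be an NFCCE, and this optimization problem is a bilinear saddle-point problem (both domains are convex polytopes and the objective is bilinear). Moreover, an NFCCE that guarantees a given lower bound $\tau\in\mathbb R$ on the social welfare can be expressed as a solution of the same saddle-point problem in which the domain of the minimization is changed from $\Xi$ to $\Xi\cap\{\xi: c^\top\xi\ge\tau\}$, with $c=\sum_{i=1}^n b_i$; this preserves the polyhedral nature of the domain. The same construction can be used verbatim if social welfare is replaced with any linear function of $\xi$.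
   Context: **Game.** $\Gamma$ is an $n$-player extensive-form game with perfect recall. Each non-leaf node $v$ belongs to a player $i\in\{1,\dots,n\}$ or to the chance player $\mathsf c$; $A_v$ is its set of actions. $Z$ is the set of leaves, $u_i(z)\in\mathbb R$ Player $i$'s payoff at $z$. The nodes of Player $i$ are partitioned into a collection $\mathcal I_i$ of information sets, with common action set $A_I$ at $I$. **Sequences.** $\Sigma_i=\{(I,a): I\in\mathcal I_i,a\in A_I\}\cup\{\varnothing_i\}$. For a node $v$, $\sigma_i(v)$ is the last $(I,a)\in\Sigma_i$ encountered on the path from the root to $v$, or $\varnothing_i$ if none; $\sigma_i(I)=\sigma_i(v)$ for any $v\in I\in\mathcal I_i$. Information sets $I_i\in\mathcal I_i$, $I_j\in\mathcal I_j$ are connected if there are $u\in I_i$, $v\in I_j$ such that the path from the root to $u$ passes through $v$ or vice versa. For $i\neq j$, sequences $\sigma_i\in\Sigma_i$, $\sigma_j\in\Sigma_j$ are relevant if one of them is empty or their information sets are connected. **Plans.** A reduced-normal-form plan $\pi$ of Player $i$ selects an action $\pi(I)\in A_I$ at exactly those $I\in\mathcal I_i$ reachable given its own other choices. $\Pi_i$ is the set of such plans; $\Pi_i(\varnothing_i)=\Pi_i$, $\Pi_i((I,a))=\Pi_i(\sigma_i(I))\cap\{\pi:\pi(I)=a\}$, and $\Pi_i(z)=\Pi_i(\sigma_i(z))$ for $z\in Z$. **Sequence-form strategies.** $Q_i\subseteq\mathbb R_{\ge0}^{\Sigma_i}$ is the set (a convex polytope) of vectors $y$ of the form $y(\sigma)=\sum_{\pi\in\Pi_i(\sigma)}\hat\mu(\pi)$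 for a probability distribution $\hat\mu$ over $\Pi_i$. **Correlation plans.** A distribution $\mu$ over $\Pi_1\times\dots\times\Pi_n$ induces the vector $\xi$, indexed by tuples $(\sigma_1,\dots,\sigma_n)\in\Sigma_1\times\dots\times\Sigma_n$ of pairwise-relevant sequences, with $\xi(\sigma_1,\dots,\sigma_n)=\sum_{\pi_1\in\Pi_1(\sigma_1),\dots,\pi_n\in\Pi_n(\sigma_n)}\mu(\pi_1,\dots,\pi_n)$. $\Xi$ is the set (a polytope) of all such $\xi$. Write $\xi_i(\sigma;z)=\xi(\sigma_1(z),\dots,\sigma_{i-1}(z),\sigma,\sigma_{i+1}(z),\dots,\sigma_n(z))$. **Matrices.** $A_i$ and $b_i$ are the matrix and vector, depending (for the given game) only on $i$, with $\xi^\top A_iy=\sum_{z\in Z}u_i(z)\xi_i(\varnothing_i;z)\,y(\sigma_i(z))$ and $b_i^\top\xi=\sum_{z\in Z}u_i(z)\xi_i(\sigma_i(z);z)$ for all $\xi$ and $y\in\mathbb R^{\Sigma_i}$. **NFCCE (normal-form coarse-correlated equilibrium).** $\mu$ is an NFCCE if for every player $i$ and every probability distribution $\hat\mu_i$ over $\Pi_i$ (independent of $\mu$), $\hat u_i\le u_i$, where the utility of deviating to $\hat\mu_i$ and the utility of committing to the recommendations are expressed as $$\hat u_i=\sum_{z\in Z}u_i(z)\Big(\sum_{\pi_i\in\Pi_i,\ \pi_j\in\Pi_j(z)\,\forall j\ne i}\mu(\pi_1,\dots,\pi_n)\Big)\Big(\sum_{\pi_i\in\Pi_i(z)}\hat\mu_i(\pi_i)\Big),\qquad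 u_i=\sum_{z\in Z}u_i(z)\sum_{\pi_j\in\Pi_j(z)\,\forall j}\mu(\pi_1,\dots,\pi_n).$$ A correlation plan $\xi\in\Xi$ is called an NFCCE if it is induced by some $\mu$ that is an NFCCE. Social welfare is $\sum_{i=1}^n u_i$, which equals $c^\top\xi$ with $c=\sum_i b_i$ for the induced $\xi$. **Bilinear saddle-point problem.** An optimization problem of the form $\operatorname{argmin}_{x\in\mathcal X}\max_{y\in\mathcal Y}x^\top Ay$ with $\mathcal X,\mathcal Y$ convex and compact. *)

(* Defs.v *)
From HB Require Import structures.
From mathcomp Require Import all_boot all_order all_algebra.
From mathcomp Require Import all_classical all_reals all_analysis.

Set Implicit Arguments.
Unset Strict Implicit.
Unset Printing Implicit Defensive.

Import Order.TTheory GRing.Theory Num.Theory.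
Import numFieldNormedType.Exports.

Local Open Scope ring_scope.

(* An n-player extensive-form game on a finite tree.  [edge v] is the pair
   (parent of v, action leading to v), and is None exactly at the root.
   [label v] is the information set of v when v belongs to one of the players;
   it is None when v is a leaf or a node of the chance player.  All players'
   information sets live in one type, [owner I] being the player that I belongs
   to.  [payoff] matters only at the leaves, and no chance probabilities are
   recorded: the utilities below are sums of payoffs over leaves, so the
   probability that chance plays towards z is part of [payoff i z]. *)
Record game (R : realType) (n : nat) := Game {
  node : finType;
  action : finType;
  infoset : finType;
  root : node;
  edge : node -> option (node * action);
  label : node -> option infoset;
  owner : infoset -> 'I_n;
  acts : infoset -> {set action};
  payoff : 'I_n -> node -> R;
  edge_root : forall v, (edge v == None) = (v == root);
  edge_inj : forall v w, v != root -> edge v = edge w -> v = w;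
  root_reached : forall v,
    fconnect (fun w => if edge w is Some e then e.1 else w) v root;
  infoset_inhabited : forall I, exists v, label v = Some I;
  acts_inhabited : forall I, acts I != finset.set0;
  label_acts : forall v I, label v = Some I ->
    forall a, (a \in acts I) = [exists w, edge w == Some (v, a)]
}.

Section Tree.
Variables (R : realType) (n : nat) (G : game R n).
Implicit Types (i j : 'I_n) (u v w z : node G) (I J : infoset G).

Definition parent v : node G := if edge v is Some e then e.1 else v.

(* The root being a fixed point of [parent], [orbit parent v] lists the path
   from v up to the root. *)
Definition on_path u v : bool := u \in orbit parent v.

Definition leaves : {set node G} :=
  [set z | [forall w, forall a, edge w != Some (z, a)]]%SET.

Notation infoact := (infoset G * action G)%type.

Definition own_move i (e : node G * action G) : option infoact :=
  if label e.1 is Some J then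
    if owner J == i then Some (J, e.2) else None
  else None.

(* Player i's pairs (I, a) met between the root and v, latest first. *)
Definition history i v : seq infoact :=
  pmap (own_move i) (pmap (@edge R n G) (orbit parent v)).

Definition perfect_recall : Prop := forall u v I,
  label u = Some I -> label v = Some I ->
  history (owner I) u = history (owner I) v.

(* Sequences are [None] (the empty one) or [Some (I, a)]. *)
Definition sigma i v : option infoact := ohead (history i v).

Definition seqs i : {set option infoact} :=
  [set s | if s is Some p then (owner p.1 == i) && (p.2 \in acts p.1)
           else true]%SET.

(* Under perfect recall the node picked in I is irrelevant. *)
Definition historyI I : seq infoact :=
  if [pick v | label v == Some I] is Some v then history (owner I) v else [::].

Definition sigmaI I : option infoact := ohead (historyI I).

Definition connected I J : bool :=
  [exists u, exists v, [&& label u == Some I, label v == Some J &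
     on_path v u || on_path u v]].

Definition relevant (s t : option infoact) : bool :=
  match s, t with
  | Some p, Some q => connected p.1 q.1
  | _, _ => true
  end.

Definition plan := {ffun infoset G -> option (action G)}.

(* I is reachable given the plan's own choices. *)
Definition reachable i (p : plan) I : bool :=
  [exists v, (label v == Some I) &&
     all (fun s : infoact => p s.1 == Some s.2) (history i v)].

(* Reduced-normal-form plans: an action at the reachable information sets of
   player i, and None everywhere else. *)
Definition plans i : {set plan} :=
  [set p : plan | [forall I,
     if (owner I == i) && reachable i p I
     then (if p I is Some a then a \in acts I else false)
     else p I == None]]%SET.

(* Pi_i(s); the recursion Pi_i((I,a)) = Pi_i(sigma_i(I)) /\ {p(I) = a} unfolds
   along the history of I, see [plans_at_rec] below. *)
Definition plans_at i (s : option infoact) : {set plan} :=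
  if s is Some (J, a) then
    foldr (fun t P => P :&: [set p : plan | p t.1 == Some t.2])%SET
      (plans i) ((J, a) :: historyI J)
  else plans i.

Definition plans_leaf i z : {set plan} := plans_at i (sigma i z).

Definition profile := {ffun 'I_n -> plan}.

Definition profiles : {set profile} :=
  [set pi : profile | [forall i, pi i \in plans i]]%SET.

Definition seqtype i := {s : option infoact | s \in seqs i}.

Definition relevant_tuple (t : {ffun 'I_n -> option infoact}) : bool :=
  [forall i, t i \in seqs i] &&
  [forall i, forall j, (i != j) ==> relevant (t i) (t j)].

Definition rtuple :=
  {t : {ffun 'I_n -> option infoact} | relevant_tuple t}.

(* (sigma_1(z), .., s, .., sigma_n(z)), with s in position i. *)
Definition leaf_tuple i (s : option infoact) z :
    {ffun 'I_n -> option infoact} :=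
  [ffun j => if j == i then s else sigma j z].

(* Index set of the vectors (lambda, y_1, .., y_n). *)
Definition dual_index := ('I_n + {i : 'I_n & seqtype i})%type.

Lemma orbit_parent v e : edge v = Some e ->
  orbit (@parent) v = v :: orbit (@parent) e.1.
Proof.
move=> ev; have pv : parent v = e.1 by rewrite /parent ev.
have proot : parent (root G) = root G.
  by rewrite /parent; have /eqP -> : edge (root G) == None by rewrite edge_root.
have vNroot : v != root G by rewrite -edge_root ev.
have vN : ~~ fconnect (@parent) e.1 v.
  apply/negP => /iter_findex; set k := findex _ _ _ => kv.
  have kv' m : iter (m * k.+1) (@parent) v = v.
    by elim: m => // m IHm; rewrite mulSn iterD IHm iterSr pv.
  have /iter_findex := root_reached v; set m := findex _ _ _ => mv.
  have : iter (m * k.+1) (@parent) v = root G.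
    rewrite -(@subnK m (m * k.+1)) ?leq_pmulr // iterD.
    have -> : iter m (@parent) v = root G by [].
    by elim: (_ - m)%N => //= q ->.
  by rewrite kv' => vr; rewrite vr eqxx in vNroot.
have E : order (@parent) v = (order (@parent) e.1).+1.
  rewrite /order (cardD1 v) inE connect0 add1n; congr _.+1.
  apply: eq_card => w; rewrite !inE.
  have [->|wv] := eqVneq w v; first by rewrite (negPf vN).
  rewrite fconnect_eqVf pv eq_sym (negPf wv) /=; by [].
by rewrite /orbit E trajectS pv.
Qed.

Lemma history_step i v e : edge v = Some e ->
  history i v = if own_move i e is Some s then s :: history i e.1
                else history i e.1.
Proof. by move=> ev; rewrite /history (orbit_parent ev) /= ev /=; case: own_move. Qed.

Lemma history_root i : history i (root G) = [::].
Proof.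
have er : edge (root G) = None by apply/eqP; rewrite edge_root.
rewrite /history /orbit.
have -> : order (@parent) (root G) = 1%N.
  rewrite /order -(card1 (root G)); apply: eq_card => w; rewrite !inE.
  apply/idP/eqP => [/iter_findex <-|->]; last exact: connect0.
  by elim: findex => //= k ->; rewrite /parent er.
by rewrite /= er.
Qed.

Lemma tree_ind (P : node G -> Prop) : P (root G) ->
  (forall v e, edge v = Some e -> P e.1 -> P v) -> forall v, P v.
Proof.
move=> Pr Ps v.
have [k] : exists k, iter k (@parent) v = root G.
  by have := iter_findex (root_reached v); exists (findex (@parent) v (root G)).
elim: k v => [v /= -> //|k IHk v]; rewrite iterSr => kv.
have := IHk _ kv; rewrite /parent; case ev: (edge v) => [e|//].
exact: Ps ev.
Qed.

(* The latest move (J, a) of player i above v is made at a node w of J, and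
   what precedes it is the history at w. *)
Lemma history_cons i v (s : infoact) h : history i v = s :: h ->
  exists u w, [/\ on_path u v, edge u = Some (w, s.2), label w = Some s.1,
    owner s.1 = i & h = history i w].
Proof.
elim/tree_ind: v => [|v e ev IHv]; first by rewrite history_root.
rewrite (history_step _ ev); case oe: own_move => [t|].
  move=> [<- <-]; exists v, e.1; move: oe ev; rewrite /own_move.
  case: e {IHv} => p a /=; case labp : (label p) => [J|//].
  case: eqP => // oJ [<-] ev; split=> //; by rewrite /on_path -fconnect_orbit connect0.
move=> /IHv[u [w [vu uw lw ow hw]]]; exists u, w; split=> //.
by rewrite /on_path (orbit_parent ev) inE [_ \in orbit _ _]vu orbT.
Qed.

Lemma sigma_seqs i v : sigma i v \in seqs i.
Proof.
rewrite inE /sigma; case hv: (history i v) => [//|s h] /=.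
have [u [w [_ uw lw -> _]]] := history_cons hv.
by rewrite eqxx (label_acts lw); apply/existsP; exists u; rewrite uw.
Qed.

Lemma historyI_history v I : perfect_recall -> label v = Some I ->
  historyI I = history (owner I) v.
Proof.
move=> recall lv; rewrite /historyI; case: pickP => [u /eqP lu|/(_ v)].
  exact: recall.
by rewrite lv eqxx.
Qed.

Lemma plans_at_rec I a : perfect_recall ->
  plans_at (owner I) (Some (I, a)) =
  (plans_at (owner I) (sigmaI I) :&: [set p : plan | p I == Some a])%SET.
Proof.
move=> recall; rewrite /= ; congr (_ :&: _)%SET.
have [v lv] := infoset_inhabited I.
rewrite /sigmaI (historyI_history recall lv).
case hv: (history _ v) => [//|[J b] h] /=.
have [u [w [_ _ lw ow ->]]] := history_cons hv.
by rewrite (historyI_history recall lw) ow.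
Qed.

Lemma on_pathP u v : on_path u v = fconnect (@parent) v u.
Proof. by rewrite /on_path -fconnect_orbit. Qed.

(* The last moves of two players above z are made on one path. *)
Lemma sigma_relevant i j z : relevant (sigma i z) (sigma j z).
Proof.
rewrite /sigma; case hi: (history i z) => [//|s h].
case hj: (history j z) => [|t h'] //=.
have [u [w [zu uw lw _ _]]] := history_cons hi.
have [u' [w' [zu' uw' lw' _ _]]] := history_cons hj.
have zw : fconnect (@parent) z w.
  rewrite on_pathP in zu.
  by apply: connect_trans zu (connect1 _); rewrite /= /parent uw.
have zw' : fconnect (@parent) z w'.
  rewrite on_pathP in zu'.
  by apply: connect_trans zu' (connect1 _); rewrite /= /parent uw'.
apply/existsP; exists w; apply/existsP; exists w'.
rewrite lw lw' !eqxx /= !on_pathP.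
move: (iter_findex zw) (iter_findex zw'); move: (findex _ _ w) (findex _ _ w').
move=> k k' <- <-; have [le|/ltnW le] := leqP k k'.
  by rewrite -(subnK le) iterD fconnect_iter.
by rewrite -(subnK le) iterD fconnect_iter orbT.
Qed.

Lemma leaf_tuple_relevant i z (s : option infoact) :
  s = None \/ s = sigma i z -> relevant_tuple (leaf_tuple i s z).
Proof.
move=> hs; apply/andP; split.
  apply/forallP => j; rewrite ffunE; case: eqP => [->|_]; last exact: sigma_seqs.
  by case: hs => ->; [rewrite inE|exact: sigma_seqs].
apply/forallP => j; apply/forallP => k; apply/implyP => jk; rewrite !ffunE.
by case: hs => ->; case: eqP => _; case: eqP => _; rewrite ?sigma_relevant //;
  case: (sigma j z).
Qed.

End Tree.

Arguments leaves {R n} G.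
Arguments perfect_recall {R n} G.
Arguments seqs {R n} G i.
Arguments seqtype {R n} G i.
Arguments rtuple {R n} G.
Arguments plan {R n} G.
Arguments plans {R n} G i.
Arguments plans_at {R n} G i s.
Arguments profile {R n} G.
Arguments profiles {R n} G.
Arguments dual_index {R n} G.

Local Open Scope classical_set_scope.

Section Polytopes.
Variable R : realType.

(* Convex hull of finitely many points (k = 0 gives the empty polytope). *)
Definition polytope m (S : set 'cV[R]_m) : Prop :=
  exists (k : nat) (p : 'I_k -> 'cV[R]_m),
    S = [set x | exists w : 'I_k -> R,
      [/\ forall j, 0 <= w j, \sum_j w j = 1 & x = \sum_j w j *: p j]].

Definition is_maximum (S : set R) (m : R) : Prop := S m /\ ubound S m.

Definition maxval (T U : Type) (Y : set U) (f : T -> U -> R) (x : T) : R :=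
  sup [set f x y | y in Y].

Definition argminmax (T U : Type) (X : set T) (Y : set U) (f : T -> U -> R) :
    set T :=
  [set x | X x /\ forall x', X x' -> maxval Y f x <= maxval Y f x'].

Definition bilinear_saddle_point_problem p q
    (X : set 'cV[R]_p) (Y : set 'cV[R]_q) (f : 'cV[R]_p -> 'cV[R]_q -> R) :=
  [/\ convex_set X /\ compact X,
      convex_set Y /\ compact Y &
      exists A : 'M[R]_(p, q), forall x y, f x y = (x^T *m A *m y) 0 0].

End Polytopes.

Section Equilibria.
Variables (R : realType) (n : nat) (G : game R n).

(* A vector indexed by a finite type T is a column of size #|T|, with the entry
   at t in row [enum_rank t]. *)
Local Notation corr_vec := 'cV[R]_#|{: rtuple G}|.
Local Notation seq_vec i := 'cV[R]_#|{: seqtype G i}|.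
Local Notation dual_vec := 'cV[R]_#|{: dual_index G}|.

Implicit Types (i : 'I_n) (xi : corr_vec)
  (mu : {ffun profile G -> R}) (hmu : {ffun plan G -> R}).

(* Entries, totalized by 0 outside the index set. *)
Definition corr_at xi (t : {ffun 'I_n -> option (infoset G * action G)}) : R :=
  if insub t is Some s then xi (enum_rank (s : rtuple G)) 0 else 0.

Definition seq_at i (y : seq_vec i) (s : option (infoset G * action G)) : R :=
  if insub s is Some s' then y (enum_rank (s' : seqtype G i)) 0 else 0.

Definition is_dist (T : finType) (D : {set T}) (p : {ffun T -> R}) : Prop :=
  [/\ forall x, 0 <= p x, forall x, x \notin D -> p x = 0 &
      \sum_(x in D) p x = 1].

Definition seq_strat i hmu : seq_vec i :=
  \col_(k < #|{: seqtype G i}|) \sum_(p in plans_at G i (val (enum_val k))) hmu p.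

Definition Q i : set (seq_vec i) :=
  [set y | exists2 hmu, is_dist (plans G i) hmu & y = seq_strat i hmu].

Definition induced_plan mu : corr_vec :=
  \col_(k < #|{: rtuple G}|) \sum_(pi : profile G |
                 [forall i, pi i \in plans_at G i (val (enum_val k) i)]) mu pi.

Definition Xi : set (corr_vec) :=
  [set xi | exists2 mu, is_dist (profiles G) mu & xi = induced_plan mu].

Definition Amx i : 'M[R]_(#|{: rtuple G}|, #|{: seqtype G i}|) :=
  \matrix_(k < #|{: rtuple G}|, l < #|{: seqtype G i}|) \sum_(z in leaves G |
      (leaf_tuple i None z == val (enum_val k)) &&
      (sigma i z == val (enum_val l))) payoff i z.

Definition bvec i : corr_vec :=
  \col_(k < #|{: rtuple G}|) \sum_(z in leaves G |
      leaf_tuple i (sigma i z) z == val (enum_val k)) payoff i z.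

Definition dev_utility i mu hmu : R :=
  \sum_(z in leaves G) payoff i z *
    (\sum_(pi in profiles G |
        [forall j, (j != i) ==> (pi j \in plans_leaf j z)]) mu pi) *
    (\sum_(p in plans_leaf i z) hmu p).

Definition utility i mu : R :=
  \sum_(z in leaves G) payoff i z *
    (\sum_(pi : profile G | [forall j, pi j \in plans_leaf j z]) mu pi).

Definition NFCCE mu : Prop :=
  is_dist (profiles G) mu /\
  forall i hmu, is_dist (plans G i) hmu -> dev_utility i mu hmu <= utility i mu.

Definition NFCCE_plan xi : Prop := exists2 mu, NFCCE mu & xi = induced_plan mu.

Definition social_welfare mu : R := \sum_i utility i mu.

Definition cvec : corr_vec := \sum_i bvec i.

Definition lam (w : dual_vec) i : R := w (enum_rank (inl i)) 0.

Definition ytil (w : dual_vec) i : seq_vec i :=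
  \col_(l < #|{: seqtype G i}|) w (enum_rank (inr (Tagged (seqtype G) (enum_val l)))) 0.

Definition Ydom : set (dual_vec) :=
  [set w | [/\ forall i, 0 <= lam w i, \sum_i lam w i = 1 &
    forall i, exists2 y, Q y & ytil w i = lam w i *: y]].

Definition objective xi (w : dual_vec) : R :=
  \sum_i ((xi^T *m Amx i *m ytil w i) 0 0
          - lam w i * ((bvec i)^T *m xi) 0 0).

(* The identities that determine Amx and bvec. *)
Lemma AmxE i xi (y : seq_vec i) :
  (xi^T *m Amx i *m y) 0 0 =
  \sum_(z in leaves G)
    payoff i z * corr_at xi (leaf_tuple i None z) * seq_at y (sigma i z).
Proof.
rewrite mxE; under eq_bigr => l _ do rewrite mxE mulr_suml.
rewrite exchange_big /=.
under eq_bigr => k _ do under eq_bigr => l _ do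
  rewrite !mxE big_mkcondr mulr_sumr mulr_suml /=.
under eq_bigr => k _ do rewrite exchange_big /=.
rewrite exchange_big; apply: eq_bigr => z _.
have rz : relevant_tuple (leaf_tuple i None z).
  by apply: leaf_tuple_relevant; left.
have sz := sigma_seqs i z.
rewrite /corr_at insubT /seq_at insubT.
rewrite (bigD1 (enum_rank (Sub (leaf_tuple i None z) rz : rtuple G))) //=.
rewrite [X in _ + X]big1 ?addr0 => [|k kz]; last first.
  apply: big1 => l _; case: andP => [[/eqP tz _]|]; last by rewrite mulr0 mul0r.
  case/negP: kz; apply/eqP; rewrite -[k]enum_valK; congr enum_rank.
  exact/val_inj/esym.
rewrite (bigD1 (enum_rank (Sub (sigma i z) sz : seqtype G i))) //=.
rewrite [X in _ + X]big1 ?addr0 => [|l lz]; last first.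
  case: andP => [[_ /eqP tz]|]; last by rewrite mulr0 mul0r.
  case/negP: lz; apply/eqP; rewrite -[l]enum_valK; congr enum_rank.
  exact/val_inj/esym.
by rewrite !enum_rankK /= !eqxx [_ * payoff i z]mulrC.
Qed.

Lemma bvecE i xi :
  ((bvec i)^T *m xi) 0 0 =
  \sum_(z in leaves G) payoff i z * corr_at xi (leaf_tuple i (sigma i z) z).
Proof.
rewrite mxE; under eq_bigr => k _ do rewrite !mxE big_mkcondr mulr_suml /=.
rewrite exchange_big; apply: eq_bigr => z _.
have rz : relevant_tuple (leaf_tuple i (sigma i z) z).
  by apply: leaf_tuple_relevant; right.
rewrite /corr_at insubT.
rewrite (bigD1 (enum_rank (Sub (leaf_tuple i (sigma i z) z) rz : rtuple G))) //=.
rewrite [X in _ + X]big1 ?addr0 => [|k kz]; last first.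
  case: eqP => [tz|]; last by rewrite mul0r.
  case/negP: kz; apply/eqP; rewrite -[k]enum_valK; congr enum_rank.
  exact/val_inj/esym.
by rewrite !enum_rankK /= eqxx.
Qed.

End Equilibria.

Arguments Q {R n} G i.
Arguments Xi {R n} G.
Arguments Ydom {R n} G.
Arguments objective {R n} G.
Arguments cvec {R n} G.

(* Main.v *)
Require Import Defs.
From HB Require Import structures.
From mathcomp Require Import all_boot all_order all_algebra.
From mathcomp Require Import all_classical all_reals all_analysis.
From mathcomp Require Import ring lra.
Import Order.TTheory GRing.Theory Num.Theory.
Import numFieldNormedType.Exports.
Local Open Scope classical_set_scope.
Local Open Scope ring_scope.

Set Implicit Arguments.
Unset Strict Implicit.
Unset Printing Implicit Defensive.

(** The maximum over [Ydom G] of the bilinear objective is attained at the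
    vertices (player, pure deviation), so it is nonpositive exactly when no
    player gains by a unilateral deviation.  Cutting a polytope with a
    half-space yields the convex hull of the remaining vertices and of the
    crossing points of the segments between the two sides; hence the restricted
    domains are polytopes as well.  An equilibrium exists by Ville's theorem of
    the alternative: multipliers certifying nonexistence would normalize to one
    mixed plan per player, but against the product of these plans the weighted
    deviation gains add up to zero. *)

(** * Distributions on finite sets *)

Section Distributions.
Variables (R : realType) (T : finType).
Implicit Types (A : {set T}) (w : {ffun T -> R}).

Definition dirac_dist (t : T) : {ffun T -> R} := [ffun s => (s == t)%:R].

Lemma is_dist_dirac A t : t \in A -> is_dist A (dirac_dist t).
Proof.
move=> At; split=> [s|s|]; first by rewrite ffunE ler0n.
  by rewrite ffunE; apply: contraNeq; rewrite pnatr_eq0 eqb0 negbK => /eqP ->.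
rewrite (bigD1 t) //= ffunE eqxx big1 ?addr0 // => s /andP[_ st].
by rewrite ffunE (negPf st).
Qed.

Lemma sum_dirac_dist (V : lmodType R) (t : T) (F : T -> V) :
  \sum_s dirac_dist t s *: F s = F t.
Proof.
rewrite (bigD1 t) //= ffunE eqxx scale1r big1 ?addr0 // => s st.
by rewrite ffunE (negPf st) scale0r.
Qed.

Lemma is_dist_sum A w : is_dist A w -> \sum_t w t = 1.
Proof.
case=> _ w0 <-; rewrite [RHS]big_mkcond; apply: eq_bigr => t _.
by case: ifPn => // /w0.
Qed.

Lemma is_distP A w : (forall t, 0 <= w t) ->
  (forall t, t \notin A -> w t = 0) -> \sum_t w t = 1 -> is_dist A w.
Proof.
move=> w_ge0 w0 w1; split=> //; rewrite -w1 big_mkcond; apply: eq_bigr => t _.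
by case: ifPn => // /w0.
Qed.

End Distributions.

(** * Convex hulls and their intersection with a half-space *)

Section Hull.
Variables (R : realType) (m : nat).

(** Weights are distributions on an arbitrary finite type, so that distributions over plans serve as
    weights directly. *)
Definition hull (T : finType) (A : {set T}) (p : T -> 'cV[R]_m) :
    set 'cV[R]_m :=
  [set x | exists2 w : {ffun T -> R}, is_dist A w & x = \sum_t w t *: p t].

Lemma mem_hull (T : finType) (A : {set T}) (p : T -> 'cV[R]_m) t :
  t \in A -> hull A p (p t).
Proof.
by move=> At; exists (dirac_dist R t);
  [exact: is_dist_dirac|rewrite sum_dirac_dist].
Qed.

(** A convex combination of convex combinations is one: the weights compose as in the law of total
    probability. *)
Lemma hull_sub (S T : finType) (B : {set S}) (A : {set T})
    (q : S -> 'cV[R]_m) (p : T -> 'cV[R]_m) :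
  (forall s, s \in B -> hull A p (q s)) -> hull B q `<=` hull A p.
Proof.
move=> BA x [w [w_ge0 w0 w1] ->].
have /choice[W HW] s : exists u : {ffun T -> R},
    s \in B -> is_dist A u /\ q s = \sum_t u t *: p t.
  have [/BA[u Au ->]|Bs] := boolP (s \in B); first by exists u.
  by exists [ffun=> 0].
have sumB : \sum_s w s *: q s = \sum_(s in B) w s *: q s.
  rewrite [RHS]big_mkcond; apply: eq_bigr => s _.
  by case: ifPn => // /w0 ->; rewrite scale0r.
exists [ffun t => \sum_(s in B) w s * W s t]; last first.
  rewrite sumB; under [RHS]eq_bigr => t _ do rewrite ffunE scaler_suml.
  rewrite exchange_big; apply: eq_bigr => s Bs.
  have [_ ->] := HW s Bs; rewrite scaler_sumr; apply: eq_bigr => t _.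
  by rewrite scalerA.
apply: is_distP => [t|t At|].
- rewrite ffunE sumr_ge0 // => s Bs; rewrite mulr_ge0 //.
  by have [[]] := HW s Bs.
- rewrite ffunE big1 // => s Bs; have [[_ W0 _] _] := HW s Bs.
  by rewrite W0 ?mulr0.
- under eq_bigr => t _ do rewrite ffunE.
  rewrite exchange_big -w1; apply: eq_bigr => s Bs.
  have [Ws _] := HW s Bs.
  by rewrite -mulr_sumr (is_dist_sum Ws) mulr1.
Qed.

Lemma polytopeE (S : set 'cV[R]_m) : polytope S <->
  exists (k : nat) (p : 'I_k -> 'cV[R]_m), S = hull [set: 'I_k]%SET p.
Proof.
have hullE k (p : 'I_k -> 'cV[R]_m) : hull [set: 'I_k]%SET p =
    [set x | exists w : 'I_k -> R,
      [/\ forall j, 0 <= w j, \sum_j w j = 1 & x = \sum_j w j *: p j]].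
  apply/seteqP; split=> x.
    by move=> [w wd ->]; exists w; split=> //; [case: wd|exact: is_dist_sum wd].
  move=> [w [w_ge0 w1 ->]]; exists [ffun j => w j]; last first.
    by apply: eq_bigr => j _; rewrite ffunE.
  apply: is_distP => [j|j|]; rewrite ?ffunE ?inE //.
  by rewrite -w1; apply: eq_bigr => j _; rewrite ffunE.
by split=> -[k [p ->]]; exists k, p; rewrite hullE.
Qed.

Lemma polytope_hull (T : finType) (A : {set T}) (p : T -> 'cV[R]_m) :
  polytope (hull A p).
Proof.
apply/polytopeE; exists #|A|, (p \o enum_val); apply/seteqP; split.
  apply: hull_sub => t At; rewrite -(enum_rankK_in At At).
  exact: (@mem_hull _ _ (p \o enum_val)).
by apply: hull_sub => j _; apply: mem_hull; exact: enum_valP.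
Qed.

Section HalfSpace.
Variables (T : finType) (a : T -> R) (w : T -> R).

Definition cut_point (V : lmodType R) (p : T -> V) (t : T + T * T) : V :=
  match t with
  | inl j => p j
  | inr (j, k) => (a j - a k)^-1 *: (- a k *: p j + a j *: p k)
  end.

Definition cut_index : {set T + T * T} :=
  [set t | match t with
           | inl j => 0 <= a j
           | inr (j, k) => (0 <= a j) && (a k < 0)
           end]%SET.

Let P := \sum_(j | 0 <= a j) w j * a j.
Let N := \sum_(k | a k < 0) w k * - a k.

(* The mass of the points beyond the hyperplane is transported to the others
   in proportion to [w j * a j]; each pair (j, k) is replaced by the point
   where the segment from j to k crosses the hyperplane. *)
Definition cut_weight : {ffun T + T * T -> R} :=
  [ffun t => match t with
   | inl j => if 0 <= a j then w j * (1 - N / P) else 0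
   | inr (j, k) => if (0 <= a j) && (a k < 0)
                   then w j * w k * (a j - a k) / P else 0
   end].

Hypotheses (w_ge0 : forall t, 0 <= w t) (wa_ge0 : 0 <= \sum_t w t * a t).

Let P_ge0 : 0 <= P.
Proof. by apply: sumr_ge0 => j aj; rewrite mulr_ge0. Qed.

Let N_ge0 : 0 <= N.
Proof. by apply: sumr_ge0 => j aj; rewrite mulr_ge0 // oppr_ge0 ltW. Qed.

(** This is [wa_ge0] split by the sign of [a]; it keeps the factor [1 - N / P] nonnegative. *)
Let NP : N <= P.
Proof.
move: wa_ge0; rewrite (bigID (fun t => 0 <= a t)) /= -/P.
under [X in _ + X]eq_bigl => t do rewrite -ltNge.
have -> : \sum_(i | a i < 0) w i * a i = - N.
  by rewrite -sumrN; apply: eq_bigr => k _; rewrite mulrN opprK.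
by rewrite subr_ge0.
Qed.

Lemma cut_weight_ge0 t : 0 <= cut_weight t.
Proof.
rewrite ffunE; case: t => [j|[j k]]; case: ifPn => //.
  move=> _; rewrite mulr_ge0 // subr_ge0.
  have [P0|P0] := eqVneq P 0; first by rewrite P0 invr0 mulr0.
  by rewrite ler_pdivrMr ?mul1r // lt_def P0.
case/andP=> aj ak; rewrite !mulr_ge0 ?invr_ge0 // subr_ge0.
exact: le_trans (ltW ak) aj.
Qed.

(** The pairs give each [p j] with [0 <= a j] back the share [N / P] that its own weight lost, and
    give each [p k] with [a k < 0] its full weight [w k]. *)
Lemma sum_cut_weight (V : lmodType R) (p : T -> V) :
  \sum_t cut_weight t *: cut_point p t = \sum_j w j *: p j.
Proof.
(* If [P = 0] the quotient is 0, but then [N = 0] too, which forces [w k = 0]. *)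
have PPw k : a k < 0 -> P / P * w k = w k.
  move=> ak; have [P0|P0] := eqVneq P 0; last by rewrite divff ?mul1r.
  have /eqP : N = 0 by apply/eqP; rewrite eq_le N_ge0 -P0 NP.
  rewrite psumr_eq0 => [|i ai]; last by rewrite mulr_ge0 // oppr_ge0 ltW.
  move=> /allP/(_ k); rewrite mem_index_enum ak /= mulf_eq0 oppr_eq0.
  by rewrite (lt_eqF ak) orbF => /(_ isT)/eqP ->; rewrite mulr0.
rewrite big_sumType /= [RHS](bigID (fun t => 0 <= a t)) /=.
have -> : \sum_i cut_weight (inl i) *: p i =
    (1 - N / P) *: \sum_(j | 0 <= a j) w j *: p j.
  rewrite scaler_sumr [RHS]big_mkcond; apply: eq_bigr => j _; rewrite ffunE.
  by case: ifP; rewrite ?scale0r // scalerA mulrC.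
have -> : \sum_i cut_weight (inr i) *: cut_point p (inr i) =
    \sum_(j | 0 <= a j) \sum_(k | a k < 0)
      ((w j * w k * - a k / P) *: p j + (w j * w k * a j / P) *: p k).
  rewrite pair_big_dep /= [RHS]big_mkcond; apply: eq_bigr => -[j k] _.
  rewrite ffunE /=; case: ifPn => [/andP[aj ak]|_]; last by rewrite scale0r.
  have ajk : a j - a k != 0 by rewrite gt_eqF // subr_gt0 (lt_le_trans ak).
  rewrite scalerA [X in X *: _](_ : _ = w j * w k / P); last first.
    by rewrite -!mulrA [P^-1 * _]mulrC !mulrA mulfK.
  rewrite scalerDr !scalerA; congr (_ *: _ + _ *: _).
    by rewrite -!mulrA [P^-1 * _]mulrC.
  by rewrite -!mulrA [P^-1 * _]mulrC.
under [X in _ + X = _]eq_bigr => j _ do rewrite big_split.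
rewrite big_split /=; under [X in _ = _ + X]eq_bigl => t do rewrite -ltNge.
have -> : \sum_(j | 0 <= a j) \sum_(k | a k < 0) (w j * w k * - a k / P) *: p j =
    (N / P) *: \sum_(j | 0 <= a j) w j *: p j.
  rewrite scaler_sumr; apply: eq_bigr => j _.
  rewrite -scaler_suml scalerA; congr (_ *: _); rewrite -mulr_suml mulrAC.
  congr (_ / P); rewrite mulr_suml; apply: eq_bigr => k _.
  by rewrite [RHS]mulrC mulrA.
rewrite exchange_big /=.
have -> : \sum_(k | a k < 0) \sum_(j | 0 <= a j) (w j * w k * a j / P) *: p k =
    \sum_(k | a k < 0) w k *: p k.
  apply: eq_bigr => k ak; rewrite -scaler_suml; congr (_ *: _).
  rewrite -[RHS](PPw _ ak) -mulr_suml mulrAC; congr (_ / P).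
  by rewrite mulr_suml; apply: eq_bigr => j _; rewrite mulrAC.
by rewrite addrA -scalerDl subrK scale1r.
Qed.

Lemma is_dist_cut_weight : \sum_t w t = 1 -> is_dist cut_index cut_weight.
Proof.
move=> w1; have w0 t : t \notin cut_index -> cut_weight t = 0.
  by rewrite ffunE inE; case: t => [j|[j k]] /negPf ->.
apply: is_distP => //; first exact: cut_weight_ge0.
rewrite -w1 -[RHS](eq_bigr _ (fun t _ => mulr1 (w t))).
(* Total mass is the barycenter of the constant 1, which every crossing point keeps since its
   coefficients add up to 1. *)
rewrite -[RHS](@sum_cut_weight R^o (fun=> 1)).
apply: eq_bigr => t _; have [|/w0->] := boolP (t \in cut_index); last first.
  by rewrite scale0r.
rewrite inE; case: t => [j|[j k]] /=; first by rewrite [RHS]mulr1.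
case/andP=> aj ak; have ajk : a j - a k != 0.
  by rewrite gt_eqF // subr_gt0 (lt_le_trans ak).
rewrite /GRing.scale /= !mulr1 [- _ + _]addrC mulVf // mulr1 //.
Qed.

End HalfSpace.

Lemma polytope_halfspace (S : set 'cV[R]_m) (ell : {scalar 'cV[R]_m}) (tau : R) :
  polytope S -> polytope (S `&` [set x | tau <= ell x]).
Proof.
(* Weights add up to 1, so subtracting [tau] at each vertex turns the constraint into
   [0 <= \sum_t w t * a t]. *)
move=> /polytopeE[k [p ->]]; pose a j := ell (p j) - tau.
suff -> : hull [set: 'I_k]%SET p `&` [set x | tau <= ell x] =
    hull (cut_index a) (cut_point a p) by exact: polytope_hull.
apply/seteqP; split=> x.
  move=> [[w wd ->] /=]; rewrite linear_sum => lw.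
  have w1 := is_dist_sum wd; have w_ge0 : forall t, 0 <= w t by case: wd.
  have wa : 0 <= \sum_t w t * a t.
    under eq_bigr => t _ do rewrite mulrBr.
    rewrite big_split /= sumrN -mulr_suml w1 mul1r subr_ge0 (le_trans lw) //.
    by apply: ler_sum => t _; rewrite linearZ.
  exists (cut_weight a w); first exact: is_dist_cut_weight.
  by rewrite sum_cut_weight.
move=> xh; split.
  apply: hull_sub xh => -[j _|[j l]]; first exact: mem_hull.
  rewrite inE => /andP[aj al] /=.
  have ajl : a j - a l > 0 by rewrite subr_gt0 (lt_le_trans al).
  (* These are the barycentric coordinates of the crossing point on the segment from [p j] to
     [p l]. *)
  exists [ffun t => (a j - a l)^-1 *
      (- a l * dirac_dist R j t + a j * dirac_dist R l t)].
    apply: is_distP => [t|t|]; first last.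
    - under eq_bigr => t _ do rewrite ffunE.
      rewrite -mulr_sumr big_split /= -!mulr_sumr.
      rewrite !(is_dist_sum (@is_dist_dirac R _ [set: 'I_k]%SET _ _)) ?inE //.
      by rewrite !mulr1 addrC mulVf // gt_eqF.
    - by rewrite inE.
    - by rewrite !ffunE mulr_ge0 ?invr_ge0 ?(ltW ajl) // addr_ge0 // mulr_ge0
        ?ler0n // oppr_ge0 ltW.
  under eq_bigr => t _ do rewrite ffunE -scalerA scalerDl -!scalerA.
  by rewrite -scaler_sumr big_split /= -!scaler_sumr !sum_dirac_dist.
case: xh => w wd ->; have w1 := is_dist_sum wd; case: wd => w_ge0 w0 _ /=.
rewrite linear_sum -[tau]mul1r -w1 mulr_suml; apply: ler_sum => t _.
rewrite linearZ /=; have [|/w0->] := boolP (t \in cut_index a); last first.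
  by rewrite !mul0r.
rewrite inE => At; apply: ler_wpM2l => //.
case: t At => [j|[j l]] /=; first by rewrite subr_ge0.
case/andP=> aj al; have ajl : a j - a l > 0 by rewrite subr_gt0 (lt_le_trans al).
rewrite linearZ /= [ell (_ + _)]linearD /=.
rewrite [ell (_ *: p j)]linearZ [ell (_ *: p l)]linearZ /=.
have -> : ell (p j) = a j + tau by rewrite subrK.
have -> : ell (p l) = a l + tau by rewrite subrK.
(* At a crossing point [ell] equals [tau] exactly. *)
rewrite [X in _ * X](_ : _ = (a j - a l) * tau); last by ring.
by rewrite mulKf // gt_eqF.
Qed.

End Hull.

(** * Convexity, compactness and extrema on polytopes; a theorem of the alternative *)

Lemma continuous_sumr (K : numFieldType) (V : normedModType K)
    (X : topologicalType) (I : Type) (r : seq I) (f : I -> X -> V) :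
  (forall i, continuous (f i)) -> continuous (fun x => \sum_(i <- r) f i x).
Proof. by move=> cf; apply: continuous_big => //; exact: add_continuous. Qed.

Section Compactness.
Variables (R : realType) (m : nat).

Lemma continuous_scalar (f : {scalar 'cV[R]_m}) : continuous (f : 'cV[R]_m -> R).
Proof.
have -> : (f : _ -> R) = (fun x : 'cV[R]_m => \sum_i x i 0 * f (delta_mx i 0)).
  apply/funext => x; rewrite [in LHS](matrix_sum_delta x) linear_sum.
  by apply: eq_bigr => i _; rewrite big_ord1 linearZ.
apply: continuous_sumr => i x.
exact: (cvgM (@coord_continuous R m 1 i 0 x) (cvg_cst _)).
Qed.

Lemma polytope_convex (S : set 'cV[R]_m) : polytope S -> convex_set S.
Proof.
move=> [k [p ->]] x y t /set_mem[u [u_ge0 u1 ->]] /set_mem[v [v_ge0 v1 ->]].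
apply/mem_set; exists (fun j => t%:num * u j + (1 - t%:num) * v j); split.
- by move=> j; rewrite addr_ge0 // mulr_ge0.
- by rewrite big_split /= -!mulr_sumr u1 v1 !mulr1 addrC subrK.
- rewrite /conv /= !scaler_sumr -big_split /=; apply: eq_bigr => j _.
  by rewrite !scalerA -scalerDl.
Qed.

(** A polytope is the continuous image of the standard simplex, a closed subset of the compact unit
    cube. *)
Lemma polytope_compact (S : set 'cV[R]_m) : polytope S -> compact S.
Proof.
move=> [k [p ->]].
pose cube := [set v : 'rV[R]_k | forall i, `[0, 1]%classic (v ord0 i)].
pose D := cube `&` [set v : 'rV[R]_k | \sum_j v ord0 j = 1].
pose f (v : 'rV[R]_k) := \sum_j v ord0 j *: p j.
have -> : [set x | exists w : 'I_k -> R,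
      [/\ forall j, 0 <= w j, \sum_j w j = 1 & x = \sum_j w j *: p j]] = f @` D.
  apply/seteqP; split=> x.
    move=> [w [w_ge0 w1 ->]]; exists (\row_j w j); last first.
      by apply: eq_bigr => j _; rewrite mxE.
    split=> [j /=|/=]; last by rewrite -w1; apply: eq_bigr => j _; rewrite mxE.
    rewrite in_itv /= mxE w_ge0 -w1 (bigD1 j) //= lerDl.
    exact: sumr_ge0.
  move=> [v [vc v1] <-]; exists (fun j => v ord0 j); split=> // j.
  by have := vc j; rewrite /= in_itv /= => /andP[].
apply: continuous_compact.
  apply: continuous_subspaceT; apply: continuous_sumr => j v.
  exact: (@cvgZr_tmp R 'cV[R]_m _ _ _ _ _ (p j)
    (@coord_continuous R 1 k ord0 j v)).
apply: compact_closedI.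
  exact: (@rV_compact R k (fun=> `[0, 1]%classic) (fun=> @segment_compact R 0 1)).
apply: (@preimage_closed _ _ (fun v : 'rV[R]_k => \sum_j v ord0 j) [set 1]).
  by move=> v _; apply: continuous_sumr => j; exact: (@coord_continuous R 1 k).
exact: closed_eq.
Qed.

(** An average of vertex values cannot exceed the largest one; the point [x] guarantees that there
    is a vertex. *)
Lemma hull_max (T : finType) (A : {set T}) (p : T -> 'cV[R]_m)
    (f : {scalar 'cV[R]_m}) x : hull A p x ->
  exists2 t, t \in A & forall y, hull A p y -> f y <= f (p t).
Proof.
move=> [u [_ _ u1] _].
have [t0 At0] : exists t, t \in A.
  apply/set0Pn; apply/eqP => A0; move: u1; rewrite A0 big_set0 => /eqP.
  by rewrite eq_sym oner_eq0.
have [t At tmax] := arg_maxP (fun t => f (p t)) At0.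
exists t => // y [w wd ->]; rewrite linear_sum.
have w1 := is_dist_sum wd; case: wd => w_ge0 w0 _.
rewrite -[leRHS]mul1r -w1 mulr_suml; apply: ler_sum => s _; rewrite linearZ /=.
have [As|/w0->] := boolP (s \in A); last by rewrite !mul0r.
by apply: ler_wpM2l => //; exact: tmax.
Qed.

Lemma continuous_bigmax (X : topologicalType) (T : Type) (r : seq T) (g0 : X -> R)
    (g : T -> X -> R) : continuous g0 -> (forall t, continuous (g t)) ->
  continuous (fun x => \big[Num.max/g0 x]_(t <- r) g t x).
Proof.
move=> cg0 cg; elim: r => [|t r IHr].
  by under eq_fun => x do rewrite big_nil.
under eq_fun => x do rewrite big_cons.
by move=> x; apply: (@continuous_max R); [exact: cg|exact: IHr].
Qed.

End Compactness.

(* Ville's theorem of the alternative.  If x minimizes the squared norm of the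
   positive part over the convex hull of the columns of M, then first-order
   optimality makes the positive part of x a suitable l. *)
Lemma ville_alternative (R : realType) (I T : finType) (A : {set T})
    (M : I -> T -> R) : A != finset.set0 ->
  (exists2 w : {ffun T -> R}, is_dist A w & forall i, \sum_t w t * M i t <= 0) \/
  (exists2 l : I -> R, forall i, 0 <= l i &
     forall t, t \in A -> 0 < \sum_i l i * M i t).
Proof.
move=> /set0Pn[t0 At0].
pose p t : 'cV[R]_#|I| := \col_i M (enum_val i) t.
pose pos (x : 'cV[R]_#|I|) i := Num.max 0 (x i 0).
pose f x : R := \sum_i pos x i ^+ 2.
have cf : continuous f.
  apply: continuous_sumr => i x.
  have cpos : pos^~ i y @[y --> x] --> pos x i.
    exact: (@continuous_max R 'cV[R]_#|I| (fun=> 0) (fun y => y i 0) x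
      (@cst_continuous 'cV[R]_#|I| R 0 x) (@coord_continuous R #|I| 1 i 0 x)).
  exact: (cvgM cpos cpos).
have S0 : hull A p !=set0 by exists (p t0); exact: mem_hull.
have cS := polytope_compact (polytope_hull A p).
have [x /set_mem Sx xmin] := compact_EVT_min S0 cS (continuous_subspaceT cf).
have pos_ge0 i : 0 <= pos x i by rewrite le_max lexx.
have [x_le0|] := pselect (forall i, x i 0 <= 0).
  left; case: Sx => w wd xw; exists w => // i.
  have := x_le0 (enum_rank i); rewrite xw summxE.
  by under eq_bigr => t _ do rewrite !mxE enum_rankK.
move=> /existsNP[i0 /negP]; rewrite -ltNge => xi0.
right; exists (fun i => pos x (enum_rank i)) => // t At.
pose d i := p t i 0 - x i 0.
(* Compare [f] at [x] and at [x + e *: (p t - x)], which is in the hull, and divide the difference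
   by [e]. *)
have step e : 0 < e -> e <= 1 ->
    0 <= 2 * (\sum_i pos x i * d i) + e * \sum_i d i ^+ 2.
  move=> e0 e1.
  have Sy : hull A p (x + e *: (p t - x)).
    have /(_ (p t) x (Itv01 (ltW e0) e1)) := polytope_convex (polytope_hull A p).
    move=> /(_ (mem_set (mem_hull p At)) (mem_set Sx))/set_mem.
    rewrite /conv /= scalerBl scale1r scalerBr.
    by rewrite addrCA.
  have := xmin _ (mem_set Sy).
  (* Coordinatewise, the positive part of [x + e d] is at most [|pos x + e d|], whatever the two
     signs; this replaces differentiability of [f]. *)
  have fy : f (x + e *: (p t - x)) <= \sum_i (pos x i + e * d i) ^+ 2.
    apply: ler_sum => i _; rewrite /pos.
    have -> : (x + e *: (p t - x)) i 0 = x i 0 + e * d i by rewrite /d !mxE.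
    have [x0|x0] := leP 0 (x i 0); have [y0|y0] := leP 0 (x i 0 + e * d i);
      rewrite ?expr0n ?sqr_ge0 //=.
    have : 0 <= e * d i by nra.
    by nra.
  have -> : 2 * (\sum_i pos x i * d i) + e * (\sum_i d i ^+ 2) =
      e^-1 * (\sum_i (pos x i + e * d i) ^+ 2 - f x).
    rewrite /f -sumrB !mulr_sumr -big_split /=; apply: eq_bigr => i _.
    by field; rewrite gt_eqF.
  by move=> fx; rewrite mulr_ge0 ?invr_ge0 ?(ltW e0) // subr_ge0 (le_trans fx).
have posd : 0 <= \sum_i pos x i * d i.
  rewrite leNgt; apply/negP => neg.
  set c := \sum_i pos x i * d i in step neg; set s := \sum_i d i ^+ 2 in step.
  have s_ge0 : 0 <= s by apply: sumr_ge0 => i _; exact: sqr_ge0.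
  (* This step size lies in (0, 1] since [c < 0 <= s], and makes [2 * c + e * s] equal to
     [c - c ^+ 2 / (s - c)], which is negative. *)
  have e0 : 0 < - c / (s - c) by rewrite divr_gt0 //; lra.
  have e1 : - c / (s - c) <= 1 by rewrite ler_pdivrMr; lra.
  have := step _ e0 e1.
  have -> : 2 * c + - c / (s - c) * s = c + - c ^+ 2 / (s - c) by field; lra.
  have : 0 <= c ^+ 2 / (s - c) by rewrite divr_ge0 ?sqr_ge0 //; lra.
  by rewrite mulNr; lra.
have -> : \sum_i pos x (enum_rank i) * M i t = \sum_i pos x i * p t i 0.
  rewrite (reindex enum_rank) /=; last exact: onW_bij (enum_rank_bij _).
  by apply: eq_bigr => i _; rewrite mxE enum_rankK.
(* Since [pos x i * x i 0 = pos x i ^+ 2], the remainder is [f x], positive because of the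
   coordinate [i0]. *)
have -> : \sum_i pos x i * p t i 0 = \sum_i pos x i * d i + f x.
  rewrite -big_split /=; apply: eq_bigr => i _; rewrite /d /pos.
  by have [x0|x0] := leP 0 (x i 0); [ring|rewrite !mul0r expr0n addr0].
apply: ltr_wpDl => //; rewrite /f (bigD1 i0) //= ltr_pwDl //.
  by rewrite exprn_gt0 // lt_max xi0 orbT.
by apply: sumr_ge0 => i _; exact: sqr_ge0.
Qed.

(** * Bilinear saddle-point problems over polytopes *)

Section Saddle.
Variable R : realType.

Definition row_form m (c : 'rV[R]_m) (x : 'cV[R]_m) : R := (c *m x) 0 0.

Fact row_form_is_scalar m (c : 'rV[R]_m) : scalar (row_form c).
Proof. by move=> a x y; rewrite /row_form mulmxDr -scalemxAr !mxE. Qed.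

HB.instance Definition _ m (c : 'rV[R]_m) :=
  GRing.isLinear.Build R 'cV[R]_m R *%R (row_form c) (row_form_is_scalar c).

Variables (p q : nat) (X : set 'cV[R]_p) (Y : set 'cV[R]_q) (A : 'M[R]_(p, q)).
Hypotheses (polX : polytope X) (polY : polytope Y) (Y0 : Y !=set0).
Variable f : 'cV[R]_p -> 'cV[R]_q -> R.
Hypothesis fE : forall x y, f x y = (x^T *m A *m y) 0 0.

Lemma bilinear_saddle_point_polytope : bilinear_saddle_point_problem X Y f.
Proof.
split; last by exists A.
- by split; [exact: polytope_convex|exact: polytope_compact].
- by split; [exact: polytope_convex|exact: polytope_compact].
Qed.

(** For fixed [x] the objective is linear in [y], so the supremum is attained at a vertex of [Y]. *)
Lemma maxval_is_maximum x : is_maximum [set f x y | y in Y] (maxval Y f x).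
Proof.
have [k [v Yv]] := (polytopeE Y).1 polY; have [y0 Yy0] := Y0.
have fx y : f x y = row_form (x^T *m A) y by rewrite fE.
rewrite Yv in Yy0; have [t _ tmax] := hull_max (row_form (x^T *m A)) Yy0.
have ub : ubound [set f x y | y in Y] (f x (v t)).
  by move=> _ [y Yy <-]; rewrite !fx; apply: tmax; rewrite -Yv.
have St : [set f x y | y in Y] (f x (v t)).
  by exists (v t) => //; rewrite Yv; apply: mem_hull; rewrite inE.
suff -> : maxval Y f x = f x (v t) by [].
apply/eqP; rewrite eq_le; apply/andP; split.
  by apply: ge_sup => //; exists (f x (v t)).
by apply: ub_le_sup => //; exists (f x (v t)).
Qed.

(** The inner maximum is a maximum over finitely many vertices of functions linear in [x]. *)
Lemma maxval_continuous : continuous (maxval Y f).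
Proof.
have [k [v Yv]] := (polytopeE Y).1 polY; have [y0 Yy0] := Y0.
(* The zero form serves only to extract some vertex index, the seed of the iterated maximum. *)
have [t0 _ _] : exists2 t, t \in [set: 'I_k]%SET &
    forall y, hull [set: 'I_k]%SET v y -> row_form 0 y <= row_form 0 (v t).
  by apply: (@hull_max _ _ _ _ _ (row_form 0) y0); rewrite -Yv.
have Yvt t : Y (v t) by rewrite Yv; apply: mem_hull; rewrite inE.
have -> : maxval Y f =
    (fun x => \big[Num.max/f x (v t0)]_(t <- index_enum 'I_k) f x (v t)).
  apply/funext => x; have [[y Yy yE] ub] := maxval_is_maximum x.
  apply/eqP; rewrite eq_le; apply/andP; split; last first.
    apply: bigmax_le => [|t _]; apply: ub; first by exists (v t0).
    by exists (v t).
  have /(hull_max (row_form (x^T *m A)))[t _ tmax] : hull [set: 'I_k]%SET v y.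
    by rewrite -Yv.
  rewrite -yE.
  apply: (le_trans _ (le_bigmax _ (fun t => f x (v t)) t)) => /=.
  by rewrite !fE; apply: tmax; rewrite -Yv.
have cf y : continuous (f^~ y).
  have -> : f^~ y = row_form (A *m y)^T.
    apply/funext => x; rewrite fE /row_form -[in RHS](trmxK x) -trmx_mul.
    by rewrite mulmxA [RHS]mxE.
  exact: continuous_scalar.
exact: continuous_bigmax.
Qed.

Lemma argminmax_nonempty : X !=set0 -> argminmax X Y f !=set0.
Proof.
move=> X0; have [x Xx xmin] := compact_EVT_min X0 (polytope_compact polX)
  (continuous_subspaceT maxval_continuous).
by exists x; split=> [|x' Xx']; [exact: set_mem|apply: xmin; exact: mem_set].
Qed.

End Saddle.

(** * Plans, and the two domains as convex hulls *)

Lemma sum_pairE (V : nmodType) (I J : finType) (f : I * J -> V) :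
  \sum_x f x = \sum_i \sum_j f (i, j).
Proof. by rewrite pair_big; apply: eq_bigr => -[]. Qed.

Lemma sum_dirac_cond (R : realType) (T : finType) (t : T) (P : pred T) :
  \sum_(s | P s) dirac_dist R t s = (P t)%:R.
Proof.
rewrite big_mkcond -[RHS](@sum_dirac_dist R T R^o t (fun s => (P s)%:R)).
by apply: eq_bigr => s _; case: (P s); rewrite ?scaler0 // [RHS]mulr1.
Qed.

Lemma sum_support (R : realType) (T : finType) (f : T -> R) (P : pred T) :
  \sum_(t | P t) f t = \sum_t f t * (P t)%:R.
Proof.
by rewrite big_mkcond; apply: eq_bigr => t _; case: (P t); rewrite ?mulr1 ?mulr0.
Qed.

(** When the total mass is 0, [f] vanishes identically and any distribution on [A] will do. *)
Lemma normalize_dist (R : realType) (T : finType) (A : {set T}) (f : T -> R) :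
  A != finset.set0 -> (forall t, 0 <= f t) -> (forall t, t \notin A -> f t = 0) ->
  exists2 w : {ffun T -> R}, is_dist A w & forall t, f t = (\sum_s f s) * w t.
Proof.
move=> /set0Pn[t0 At0] f_ge0 f0; have [F0|F0] := eqVneq (\sum_s f s) 0.
  exists (dirac_dist R t0); first exact: is_dist_dirac.
  move=> t; rewrite F0 mul0r; move/eqP: F0; rewrite psumr_eq0 //.
  by move=> /allP/(_ t); rewrite mem_index_enum => /(_ isT)/eqP.
exists [ffun t => f t / \sum_s f s]; last first.
  by move=> t; rewrite ffunE mulrC divfK.
apply: is_distP => [t|t At|].
- by rewrite ffunE divr_ge0 // sumr_ge0.
- by rewrite ffunE f0 // mul0r.
- by under eq_bigr => t _ do rewrite ffunE; rewrite -mulr_suml divff.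
Qed.

Section Plans.
Variables (R : realType) (n : nat) (G : game R n).
Implicit Types (i j : 'I_n) (mu : {ffun profile G -> R})
  (hmu : {ffun plan G -> R}).

(** Fix one action [s I] everywhere and erase it at the information sets of player [i] that [s]
    itself does not reach. *)
Lemma plans_neq0 i : plans G i != finset.set0.
Proof.
have /choice[s sP] : forall I : infoset G, exists a, a \in acts I.
  by move=> I; apply/set0Pn; exact: acts_inhabited.
pose reach v := all (fun t : infoset G * action G => s t.1 == t.2) (history i v).
pose p : plan G := [ffun I =>
  if (owner I == i) && [exists v, (label v == Some I) && reach v]
  then Some (s I) else None].
(* Erasing does not alter reachability. By induction on the length of the history: once the earlier
   moves follow [s], the node [w] of the latest move shows that [p] keeps the action of [s]
   there. *)
have reachE v : all (fun t : infoset G * action G => p t.1 == Some t.2)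
    (history i v) = reach v.
  rewrite /reach; move: {2}(size _) (leqnn (size (history i v))) => k.
  elim: k v => [|k IHk] v; first by rewrite leqn0 size_eq0 => /eqP ->.
  case hv: (history i v) => [//|t h] /= hk.
  have [u [w [_ _ lw ow hE]]] := history_cons hv.
  rewrite hE in hk *; rewrite IHk // andbC [RHS]andbC.
  apply: andb_id2l => rw; rewrite ffunE ow eqxx /=.
  suff -> : [exists v, (label v == Some t.1) && reach v] by [].
  by apply/existsP; exists w; rewrite lw eqxx.
apply/set0Pn; exists p; rewrite inE; apply/forallP => I.
have -> : reachable i p I = [exists v, (label v == Some I) && reach v].
  by apply: eq_existsb => v; rewrite reachE.
rewrite ffunE; case: ((owner I == i) && _) => /=; [exact: sP|by []].
Qed.

Lemma plans_at_sub i s : plans_at G i s \subset plans G i.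
Proof.
case: s => [[J a]|] //=.
have sub (l : seq (infoset G * action G)) :
    foldr (fun t P => P :&: [set p : plan G | p t.1 == Some t.2])%SET
      (plans G i) l \subset plans G i.
  by elim: l => //= t l; exact: (fintype.subset_trans (finset.subsetIl _ _)).
exact: (sub ((J, a) :: historyI J)).
Qed.

Lemma induced_plan_sum mu :
  induced_plan mu = \sum_pi mu pi *: induced_plan (dirac_dist R pi).
Proof.
apply/colP => k; rewrite mxE summxE sum_support; apply: eq_bigr => pi _.
by rewrite !mxE sum_dirac_cond.
Qed.

Lemma seq_strat_sum i hmu :
  seq_strat i hmu = \sum_p hmu p *: seq_strat i (dirac_dist R p).
Proof.
apply/colP => k; rewrite mxE summxE sum_support; apply: eq_bigr => p _.
by rewrite !mxE sum_dirac_cond.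
Qed.

Lemma XiE :
  Xi G = hull (profiles G) (fun pi => induced_plan (dirac_dist R pi)).
Proof.
by apply/seteqP; split=> _ [mu muP ->]; exists mu => //; rewrite induced_plan_sum.
Qed.

(** Player [ip.1] gets all the weight and deviates to the pure plan [ip.2]; the blocks of the other
    players are 0. *)
Definition dual_vertex (ip : 'I_n * plan G) : 'cV[R]_#|{: dual_index G}| :=
  \col_k match enum_val k with
         | inl j => (j == ip.1)%:R
         | inr js => ((tag js == ip.1) &&
                      (ip.2 \in plans_at G (tag js) (val (tagged js))))%:R
         end.

Lemma lam_dual_vertex i p j : lam (dual_vertex (i, p)) j = (j == i)%:R.
Proof. by rewrite /lam mxE enum_rankK. Qed.

Lemma ytil_dual_vertex i p j :
  ytil (dual_vertex (i, p)) j = (j == i)%:R *: seq_strat j (dirac_dist R p).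
Proof.
apply/colP => k; rewrite !mxE enum_rankK /= sum_dirac_cond.
by rewrite -natrM mulnb.
Qed.

Lemma dual_vecP (w w' : 'cV[R]_#|{: dual_index G}|) :
  lam w =1 lam w' -> (forall i, ytil w i = ytil w' i) -> w = w'.
Proof.
move=> ll yy; apply/colP => k; rewrite -(enum_valK k).
case: (enum_val k) => [i|[i s]]; first exact: ll.
by have /colP/(_ (enum_rank s)) := yy i; rewrite !mxE enum_rankK.
Qed.

Section DualCombination.
Variable nu : 'I_n * plan G -> R.

Lemma lam_sum_dual_vertex i :
  lam (\sum_ip nu ip *: dual_vertex ip) i = \sum_p nu (i, p).
Proof.
have -> : lam (\sum_ip nu ip *: dual_vertex ip) i =
    \sum_ip nu ip * lam (dual_vertex ip) i.
  by rewrite /lam summxE; apply: eq_bigr => ip _; rewrite mxE.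
rewrite sum_pairE (bigD1 i) //= [X in _ + X]big1 ?addr0 => [|j ji].
  by apply: eq_bigr => p _; rewrite lam_dual_vertex eqxx mulr1.
by apply: big1 => p _; rewrite lam_dual_vertex eq_sym (negPf ji) mulr0.
Qed.

Lemma ytil_sum_dual_vertex i :
  ytil (\sum_ip nu ip *: dual_vertex ip) i =
  \sum_p nu (i, p) *: seq_strat i (dirac_dist R p).
Proof.
have -> : ytil (\sum_ip nu ip *: dual_vertex ip) i =
    \sum_ip nu ip *: ytil (dual_vertex ip) i.
  apply/colP => k; rewrite mxE !summxE; apply: eq_bigr => ip _.
  by rewrite !mxE.
rewrite sum_pairE (bigD1 i) //= [X in _ + X]big1 ?addr0 => [|j ji].
  by apply: eq_bigr => p _; rewrite ytil_dual_vertex eqxx scale1r.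
apply: big1 => p _.
by rewrite ytil_dual_vertex eq_sym (negPf ji) scale0r scaler0.
Qed.

End DualCombination.

(** A point of the domain puts weight [lam w i * hmu i p] on the vertex [(i, p)]. Conversely, player
    [i]'s share of the weights, normalized, is a mixed plan; [normalize_dist] covers the share 0. *)
Lemma YdomE :
  Ydom G = hull [set ip : 'I_n * plan G | ip.2 \in plans G ip.1]%SET dual_vertex.
Proof.
apply/seteqP; split=> w.
  move=> [lam_ge0 lam1 wQ].
  have /choice[hmu hmuP] i : exists hmu, is_dist (plans G i) hmu /\
      ytil w i = lam w i *: seq_strat i hmu.
    by have [_ [hmu hP ->] yE] := wQ i; exists hmu.
  pose nu (ip : 'I_n * plan G) := lam w ip.1 * hmu ip.1 ip.2.
  have nu1 i : \sum_p nu (i, p) = lam w i.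
    by rewrite /nu /= -mulr_sumr (is_dist_sum (hmuP i).1) mulr1.
  exists [ffun ip => nu ip].
    apply: is_distP => [[i p]|[i p]|]; rewrite ?ffunE.
    - by rewrite mulr_ge0 //; case: (hmuP i) => -[].
    - by rewrite inE /= /nu => ip; case: (hmuP i) => -[_ -> //]; rewrite mulr0.
    - rewrite -lam1; under eq_bigr => ip _ do rewrite ffunE.
      by rewrite sum_pairE; apply: eq_bigr => i _; exact: nu1.
  under eq_bigr => ip _ do rewrite ffunE.
  apply: dual_vecP => i; first by rewrite lam_sum_dual_vertex nu1.
  rewrite ytil_sum_dual_vertex (hmuP i).2 seq_strat_sum scaler_sumr.
  by apply: eq_bigr => p _; rewrite scalerA.
move=> [nu nud ->]; have nu1 := is_dist_sum nud.
case: nud => nu_ge0 nu0 _; split=> [i||i].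
- by rewrite lam_sum_dual_vertex sumr_ge0.
- under eq_bigr => i _ do rewrite lam_sum_dual_vertex.
  by rewrite -sum_pairE.
- have [||hmu hd hE] := @normalize_dist R _ (plans G i) (fun p => nu (i, p))
    (plans_neq0 i); first by [].
    by move=> p ip; apply: nu0; rewrite inE.
  exists (seq_strat i hmu); first by exists hmu.
  rewrite ytil_sum_dual_vertex lam_sum_dual_vertex seq_strat_sum scaler_sumr.
  by apply: eq_bigr => p _; rewrite scalerA -hE.
Qed.

Lemma Ydom_neq0 : (0 < n)%N -> Ydom G !=set0.
Proof.
move=> n_gt0; have /set0Pn[p ip] := plans_neq0 (Ordinal n_gt0).
exists (dual_vertex (Ordinal n_gt0, p)).
by rewrite YdomE; apply: mem_hull; rewrite inE.
Qed.

(** Putting all of [lam] on player [i] isolates the incentive constraint of that player against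
    [hmu]. *)
Lemma Ydom_pure i hmu : is_dist (plans G i) hmu ->
  exists2 w, Ydom G w & forall xi, objective G xi w =
    (xi^T *m Amx G i *m seq_strat i hmu) 0 0 - ((bvec G i)^T *m xi) 0 0.
Proof.
move=> hd; pose w : 'cV[R]_#|{: dual_index G}| :=
  \sum_ip (if ip.1 == i then hmu ip.2 else 0) *: dual_vertex ip.
have lamw j : lam w j = (j == i)%:R.
  rewrite lam_sum_dual_vertex /=; case: eqP => _; first exact: is_dist_sum hd.
  by rewrite big1.
have ytilw j : ytil w j = (j == i)%:R *: seq_strat j hmu.
  rewrite ytil_sum_dual_vertex seq_strat_sum scaler_sumr /=.
  by apply: eq_bigr => p _; case: eqP; rewrite ?scale1r ?scale0r.
exists w.
  split=> [j||j]; first by rewrite lamw ler0n.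
    rewrite (eq_bigr _ (fun j _ => lamw j)) (bigD1 i) //= eqxx big1 ?addr0 //.
    by move=> j /negPf ->.
  rewrite ytilw lamw; have [->|ji] := eqVneq j i.
    by exists (seq_strat i hmu) => //; exists hmu.
  (* Here [lam w j = 0], but membership still asks for some point of [Q j] to be scaled by 0. *)
  have /set0Pn[p jp] := plans_neq0 j.
  exists (seq_strat j (dirac_dist R p)); last by rewrite !scale0r.
  by exists (dirac_dist R p) => //; exact: is_dist_dirac.
move=> xi; rewrite /objective (bigD1 i) //= big1 ?addr0.
  by rewrite lamw ytilw eqxx scale1r mul1r.
by move=> j /negPf ji; rewrite lamw ytilw ji scale0r mulmx0 mxE mul0r subrr.
Qed.

(** The row selection of the identity extracts the block [ytil w i], and the [delta_mx] row extracts
    [lam w i]. *)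
Definition objective_mx : 'M[R]_(#|{: rtuple G}|, #|{: dual_index G}|) :=
  \sum_i (Amx G i *m
      rowsub (fun l => enum_rank (inr (Tagged (seqtype G) (enum_val l))))
        1%:M
    - bvec G i *m delta_mx 0 (enum_rank (inl i))).

Lemma objectiveE xi w : objective G xi w = (xi^T *m objective_mx *m w) 0 0.
Proof.
rewrite mulmx_sumr mulmx_suml summxE; apply: eq_bigr => i _.
rewrite mulmxBr mulmxBl [RHS]mxE; congr (_ + _).
  rewrite -!mulmxA mul_rowsub_mx mul1mx; congr ((_ *m (_ *m _)) 0 0).
  by apply/colP => l; rewrite !mxE.
rewrite [RHS]mxE; congr (- _).
rewrite -!mulmxA -rowE mulmxA [RHS]mxE big_ord1 mulrC [row _ _ _ _]mxE.
by rewrite -[in RHS](trmxK (bvec G i)) -trmx_mul [(_^T) 0 0]mxE.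
Qed.

Lemma corr_at_induced_plan mu t : relevant_tuple t ->
  corr_at (induced_plan mu) t =
  \sum_(pi : profile G | [forall i, pi i \in plans_at G i (t i)]) mu pi.
Proof. by move=> rt; rewrite /corr_at insubT mxE enum_rankK. Qed.

Lemma seq_at_seq_strat i hmu s : s \in seqs G i ->
  seq_at (seq_strat i hmu) s = \sum_(p in plans_at G i s) hmu p.
Proof. by move=> si; rewrite /seq_at insubT mxE enum_rankK. Qed.

Lemma dev_utilityE i mu hmu : dev_utility i mu hmu =
  ((induced_plan mu)^T *m Amx G i *m seq_strat i hmu) 0 0.
Proof.
rewrite AmxE; apply: eq_bigr => z _.
rewrite seq_at_seq_strat ?sigma_seqs // corr_at_induced_plan; last first.
  by apply: leaf_tuple_relevant; left.
(* The empty sequence in position [i] only asks [pi i] to be a plan; for the others, plans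
   compatible with [z] are plans, whence the membership in [profiles G]. *)
congr (_ * _ * _); apply: eq_bigl => pi; rewrite inE.
apply/andP/forallP => [[/forallP pis /forallP piz] j|piz].
  rewrite ffunE; case: eqP => [->|/eqP ji]; first exact: pis.
  exact: (implyP (piz j)).
split; apply/forallP => j; last first.
  by apply/implyP => /negPf ji; have := piz j; rewrite ffunE ji.
by apply: (fintype.subsetP (plans_at_sub j _)); exact: piz.
Qed.

Lemma utilityE i mu : utility i mu = ((bvec G i)^T *m induced_plan mu) 0 0.
Proof.
rewrite bvecE; apply: eq_bigr => z _; rewrite corr_at_induced_plan; last first.
  by apply: leaf_tuple_relevant; right.
congr (_ * _); apply: eq_bigl => pi; apply: eq_forallb => j.
by rewrite ffunE /plans_leaf; case: eqP => // ->.
Qed.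

Lemma social_welfareE mu :
  social_welfare mu = ((cvec G)^T *m induced_plan mu) 0 0.
Proof.
rewrite /cvec raddf_sum mulmx_suml summxE.
by apply: eq_bigr => i _; exact: utilityE.
Qed.

End Plans.

(** * Existence of an NFCCE *)

Section Existence.
Variables (R : realType) (n : nat) (G : game R n).
Implicit Types (i j : 'I_n) (pi : profile G) (p : plan G).

Definition pure_utility i pi : R :=
  \sum_(z in leaves G) payoff i z * [forall j, pi j \in plans_leaf j z]%:R.

Definition deviate i pi p : profile G := [ffun j => if j == i then p else pi j].

Lemma utility_pure i mu : utility i mu = \sum_pi mu pi * pure_utility i pi.
Proof.
under [RHS]eq_bigr => pi _ do rewrite mulr_sumr.
rewrite exchange_big; apply: eq_bigr => z _; rewrite sum_support mulr_sumr.
by apply: eq_bigr => pi _; rewrite mulrCA.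
Qed.

(** The deviator ignores the recommendation, so [pi] and [p] are independent. Support in
    [profiles G] matches the restricted sum in [dev_utility]. *)
Lemma dev_utility_pure i mu hmu : is_dist (profiles G) mu ->
  dev_utility i mu hmu =
  \sum_pi \sum_p mu pi * hmu p * pure_utility i (deviate i pi p).
Proof.
case=> _ mu0 _.
under [RHS]eq_bigr => pi _ do
  (under eq_bigr => p _ do rewrite mulr_sumr; rewrite exchange_big).
rewrite exchange_big; apply: eq_bigr => z _.
rewrite [X in _ * X * _]sum_support [X in _ * X]sum_support.
rewrite -mulrA mulr_suml mulr_sumr; apply: eq_bigr => pi _.
rewrite !mulr_sumr; apply: eq_bigr => p _.
have [pis|/mu0->] := boolP (pi \in profiles G); last first.
  by rewrite !(mul0r, mulr0).
have -> : [forall j, deviate i pi p j \in plans_leaf j z] =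
    [forall j, (j != i) ==> (pi j \in plans_leaf j z)] && (p \in plans_leaf i z).
  apply/forallP/andP => [dz|[/forallP piz pz] j].
    split; last by have := dz i; rewrite ffunE eqxx.
    apply/forallP => j; apply/implyP => /negPf ji.
    by have := dz j; rewrite ffunE ji.
  by rewrite ffunE; case: eqP => [->//|/eqP]; exact: (implyP (piz j)).
by rewrite -!mulnb !natrM /=; ring.
Qed.

Section Product.
Variable q : 'I_n -> {ffun plan G -> R}.
Hypothesis qd : forall i, is_dist (plans G i) (q i).

Definition product_dist : {ffun profile G -> R} :=
  [ffun pi : profile G => \prod_j q j (pi j)].

Lemma is_dist_product : is_dist (profiles G) product_dist.
Proof.
apply: is_distP => [pi|pi|].
- by rewrite ffunE prodr_ge0 // => j _; case: (qd j).
- rewrite inE negb_forall => /existsP[j pj]; rewrite ffunE (bigD1 j) //=.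
  by case: (qd j) => _ -> //; rewrite mul0r.
- under eq_bigr => pi _ do rewrite ffunE.
  rewrite -(bigA_distr_bigA (fun j p => q j p)) big1 // => j _.
  exact: is_dist_sum (qd j).
Qed.

(* Drawing a fresh plan for player i from q i does not change the law of the
   profile: (pi, p) |-> (deviate i pi p, pi i) preserves the joint law. *)
Lemma product_dist_deviate i (F : profile G -> R) :
  \sum_pi \sum_p product_dist pi * q i p * F (deviate i pi p) =
  \sum_pi product_dist pi * F pi.
Proof.
pose h (x : profile G * plan G) := (deviate i x.1 x.2, x.1 i).
have hK : involutive h.
  move=> [pi p]; rewrite /h /= ffunE eqxx; congr pair.
  by apply/ffunP => j; rewrite !ffunE; case: eqP => // ->.
have hq x : product_dist (h x).1 * q i (h x).2 = product_dist x.1 * q i x.2.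
  case: x => pi p /=; rewrite !ffunE (bigD1 i) //= [in RHS](bigD1 i) //=.
  rewrite ffunE eqxx mulrAC [RHS]mulrAC; congr (_ * _); first exact: mulrC.
  by apply: eq_bigr => j /negPf ji; rewrite ffunE ji.
rewrite pair_big /= (reindex_inj (inv_inj hK)) /=.
transitivity (\sum_(x : profile G * plan G) product_dist x.1 * q i x.2 * F x.1).
  apply: eq_bigr => x _; rewrite (hq x); congr (_ * F _).
  by have := congr1 fst (hK x).
rewrite sum_pairE /=.
apply: eq_bigr => pi _; rewrite -mulr_suml -mulr_sumr.
by rewrite (is_dist_sum (qd i)) mulr1.
Qed.

End Product.

(* Hart and Schmeidler: in Ville's alternative, the multipliers of the
   deviations define one mixed plan per player, and against their product the
   expected gain of every player's deviation is zero. *)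
Lemma NFCCE_exists : exists mu : {ffun profile G -> R}, NFCCE mu.
Proof.
have profiles_neq0 : profiles G != finset.set0.
  have /choice[p pP] i := set0Pn _ (plans_neq0 G i).
  by apply/set0Pn; exists [ffun i => p i]; rewrite inE; apply/forallP => i;
    rewrite ffunE.
(* The indicator makes the constraint trivial when [ip.2] is not a plan of player [ip.1], so all
   pairs can index the rows. *)
pose gain (ip : 'I_n * plan G) pi : R := (ip.2 \in plans G ip.1)%:R *
  (pure_utility ip.1 (deviate ip.1 pi ip.2) - pure_utility ip.1 pi).
have [[mu mud mu_le0]|[l l_ge0 l_gt0]] := ville_alternative gain profiles_neq0.
  exists mu; split=> // i hmu hd.
  rewrite dev_utility_pure // utility_pure -subr_le0.
  have -> : \sum_pi mu pi * pure_utility i pi =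
      \sum_pi \sum_p mu pi * hmu p * pure_utility i pi.
    apply: eq_bigr => pi _.
    by rewrite -mulr_suml -mulr_sumr (is_dist_sum hd) mulr1.
  rewrite -sumrB; under eq_bigr => pi _ do rewrite -sumrB.
  rewrite exchange_big; apply: sumr_le0 => p _.
  have [hmu_ge0 hmu0 _] := hd.
  have -> : \sum_pi (mu pi * hmu p * pure_utility i (deviate i pi p) -
      mu pi * hmu p * pure_utility i pi) = hmu p * \sum_pi mu pi * gain (i, p) pi.
    rewrite mulr_sumr; apply: eq_bigr => pi _; rewrite /gain /=.
    by have [ip|/hmu0->] := boolP (p \in plans G i); rewrite /=; ring.
  by rewrite mulr_ge0_le0.
exfalso.
(* Masking the multipliers outside [plans G i] lets them be normalized to a mixed plan [q i]. *)
pose L i p := l (i, p) * (p \in plans G i)%:R.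
have /choice[q qP] i : exists q, is_dist (plans G i) q /\
    forall p, L i p = (\sum_s L i s) * q p.
  have [||q qd qE] := @normalize_dist R _ (plans G i) (L i) (plans_neq0 G i).
  - by move=> p; rewrite mulr_ge0 ?ler0n.
  - by move=> p /negPf ip; rewrite /L ip mulr0.
  by exists q.
have qd i := (qP i).1; have Pd := is_dist_product qd.
have : \sum_pi product_dist q pi * (\sum_ip l ip * gain ip pi) = 0.
  under eq_bigr => pi _ do rewrite mulr_sumr.
  rewrite exchange_big /=.
  rewrite sum_pairE.
  apply: big1 => i _; rewrite exchange_big /=.
  transitivity ((\sum_s L i s) * (\sum_pi \sum_p product_dist q pi * q i p *
      pure_utility i (deviate i pi p) -
      \sum_pi \sum_p product_dist q pi * q i p * pure_utility i pi)).
    rewrite -sumrB mulr_sumr; apply: eq_bigr => pi _.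
    rewrite -sumrB mulr_sumr; apply: eq_bigr => p _.
    have -> : l (i, p) * gain (i, p) pi =
        L i p * (pure_utility i (deviate i pi p) - pure_utility i pi).
      by rewrite /gain /L mulrA.
    rewrite (qP i).2; ring.
  rewrite product_dist_deviate //.
  have -> : \sum_pi \sum_p product_dist q pi * q i p * pure_utility i pi =
      \sum_pi product_dist q pi * pure_utility i pi.
    apply: eq_bigr => pi _.
    by rewrite -mulr_suml -mulr_sumr (is_dist_sum (qd i)) mulr1.
  by rewrite subrr mulr0.
have [P_ge0 P0 P1] := Pd.
(* A zero sum of nonnegative terms whose second factor is positive on profiles kills
   [product_dist q] there, against its total mass 1. *)
have term_ge0 pi : 0 <= product_dist q pi * (\sum_ip l ip * gain ip pi).
  have [pis|/P0->] := boolP (pi \in profiles G); last by rewrite mul0r.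
  by rewrite mulr_ge0 // ltW // l_gt0.
move=> /eqP; rewrite psumr_eq0 // => /allP P_eq0.
move: P1; rewrite big1 => [/eqP|pi pis]; first by rewrite eq_sym oner_eq0.
have := P_eq0 pi; rewrite mem_index_enum => /(_ isT).
by rewrite mulf_eq0 [X in _ || X]gt_eqF ?l_gt0 // orbF => /eqP.
Qed.

End Existence.

(** * Equilibria as points of nonpositive value *)

(** The objective is the [lam]-weighted sum of the players' deviation gains; the converse tests it
    at the points of [Ydom_pure]. *)
Lemma NFCCE_objective (R : realType) (n : nat) (G : game R n) mu :
  is_dist (profiles G) mu ->
  NFCCE mu <-> forall w, Ydom G w -> objective G (induced_plan mu) w <= 0.
Proof.
move=> mud; split=> [[_ mu_le] w [w_ge0 _ wQ]|mu_le].
  apply: sumr_le0 => i _; have [_ [hmu hd ->] ->] := wQ i.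
  rewrite -scalemxAr mxE -mulrBr mulr_ge0_le0 // subr_le0.
  by rewrite -dev_utilityE -utilityE mu_le.
split=> // i hmu hd; have [w Yw wE] := Ydom_pure hd.
by have := mu_le w Yw; rewrite wE subr_le0 dev_utilityE utilityE.
Qed.

(** The gains depend on [mu] only through its induced plan, so the choice of the inducing
    distribution is immaterial. *)
Lemma NFCCE_planP (R : realType) (n : nat) (G : game R n)
    (xi : 'cV[R]_#|{: rtuple G}|) : (0 < n)%N -> Xi G xi ->
  NFCCE_plan xi <-> maxval (Ydom G) (objective G) xi <= 0.
Proof.
move=> n_gt0 [mu mud ->].
have polY : polytope (Ydom G) by rewrite YdomE; exact: polytope_hull.
have [[w Yw <-] ub] := maxval_is_maximum polY (Ydom_neq0 G n_gt0)
  (@objectiveE R n G) (induced_plan mu).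
split=> [[mu' mu'E ->]|w_le0].
  by have [mu'd _] := mu'E; apply: (NFCCE_objective mu'd).1.
exists mu => //; apply/(NFCCE_objective mud) => w' Yw'.
by apply: le_trans w_le0; apply: ub; exists w'.
Qed.

Unset Implicit Arguments.

Theorem mainTheorem3 (R : realType) (n : nat) (G : game R n)
    (n_gt0 : (0 < n)%N) (recall : perfect_recall G) :
  [/\ polytope (Ydom G),
      (forall xi : 'cV[R]_#|{: rtuple G}|, Xi G xi ->
         is_maximum [set objective G xi w | w in Ydom G]
                    (maxval (Ydom G) (objective G) xi) /\
         (NFCCE_plan xi <-> maxval (Ydom G) (objective G) xi <= 0)),
      ((exists xi : 'cV[R]_#|{: rtuple G}|, NFCCE_plan xi) /\
       (forall xi, argminmax (Xi G) (Ydom G) (objective G) xi ->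
          NFCCE_plan xi)),
      (polytope (Xi G) /\
       bilinear_saddle_point_problem (Xi G) (Ydom G) (objective G)) &
      (forall tau : R,
         let X := Xi G `&` [set xi | tau <= ((cvec G)^T *m xi) 0 0] in
         [/\ polytope X,
             bilinear_saddle_point_problem X (Ydom G) (objective G) &
             (exists2 mu : {ffun profile G -> R},
                NFCCE mu & tau <= social_welfare mu) ->
             argminmax X (Ydom G) (objective G) !=set0 /\
             (forall xi, argminmax X (Ydom G) (objective G) xi ->
                NFCCE_plan xi /\
                forall mu : {ffun profile G -> R},
                  is_dist (profiles G) mu -> xi = induced_plan mu ->
                  tau <= social_welfare mu)]) /\
      (forall (ell : {scalar 'cV[R]_#|{: rtuple G}|}) (tau : R),
         let X := Xi G `&` [set xi | tau <= ell xi] in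
         [/\ polytope X,
             bilinear_saddle_point_problem X (Ydom G) (objective G) &
             (exists2 xi, NFCCE_plan xi & tau <= ell xi) ->
             argminmax X (Ydom G) (objective G) !=set0 /\
             (forall xi, argminmax X (Ydom G) (objective G) xi ->
                NFCCE_plan xi /\ tau <= ell xi)])].
Proof.
have polY : polytope (Ydom G) by rewrite YdomE; exact: polytope_hull.
have polX : polytope (Xi G) by rewrite XiE; exact: polytope_hull.
have fE := @objectiveE R n G.
have Y0 := Ydom_neq0 G n_gt0.
have NFCCE_Xi xi : NFCCE_plan xi -> Xi G xi by case=> mu [mud _] ->; exists mu.
(* One equilibrium in [X] has value at most 0, hence so does every minimizer over [X]. *)
have argmin_NFCCE X xi : X `<=` Xi G ->
    (exists2 xi0, NFCCE_plan xi0 & X xi0) ->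
    argminmax X (Ydom G) (objective G) xi -> NFCCE_plan xi.
  move=> XXi [xi0 eq0 X0] [Xx xmin]; apply/(NFCCE_planP n_gt0 (XXi _ Xx)).
  apply: le_trans (xmin _ X0) _.
  exact/(NFCCE_planP n_gt0 (NFCCE_Xi _ eq0)).
have half (ell : {scalar 'cV[R]_#|{: rtuple G}|}) tau :
    let X := Xi G `&` [set xi | tau <= ell xi] in
    [/\ polytope X,
        bilinear_saddle_point_problem X (Ydom G) (objective G) &
        (exists2 xi, NFCCE_plan xi & tau <= ell xi) ->
        argminmax X (Ydom G) (objective G) !=set0 /\
        (forall xi, argminmax X (Ydom G) (objective G) xi ->
           NFCCE_plan xi /\ tau <= ell xi)].
  move=> X; have polX' : polytope X by exact: polytope_halfspace.
  split=> //; first exact: (bilinear_saddle_point_polytope polX' polY fE).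
  move=> [xi0 eq0 tau0]; have Xxi0 : X xi0 by split=> //; exact: NFCCE_Xi.
  split; first by apply: (argminmax_nonempty polX' polY Y0 fE); exists xi0.
  move=> xi xiP; split; last by case: xiP => -[].
  by apply: argmin_NFCCE xiP => [|]; [exact: subIsetl|exists xi0].
have [mu0 mu0E] := NFCCE_exists G.
have eq0 : NFCCE_plan (induced_plan mu0) by exists mu0.
split=> //.
- move=> xi Xxi; split; last exact: NFCCE_planP.
  exact: (maxval_is_maximum polY Y0 fE).
- split; first by exists (induced_plan mu0).
  move=> xi; apply: argmin_NFCCE => //.
  by exists (induced_plan mu0) => //; exact: NFCCE_Xi.
- by split=> //; exact: (bilinear_saddle_point_polytope polX polY fE).
split=> [tau X|]; last exact: half.
(* Social welfare is the linear function given by the row [(cvec G)^T]. *)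
have [polX' saddle opt] := half (row_form (cvec G)^T) tau.
split=> // -[mu muE mutau].
have [|ne argmin] := opt.
  by exists (induced_plan mu); [exists mu|rewrite /= /row_form -social_welfareE].
split=> // xi /argmin[xieq xitau]; split=> // nu _ xiE.
by move: xitau; rewrite xiE social_welfareE.
Qed.
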